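(* Let $\mathcal{C}$ be a category with finite products and let $(\mathcal{L},\mathcal{R})$ be a weak factorisation system on $\mathcal{C}$ such that pullbacks of arrows in $\mathcal{R}$ along arbitrary arrows of $\mathcal{C}$ exist. Suppose that $\mathcal{L}$ is closed under products (i.e. for every object $X$ of $\mathcal{C}$ the functor $(-)\times X:\mathcal{C}\to\mathcal{C}$ maps $\mathcal{L}$ into $\mathcal{L}$) and under pullbacks along arrows in $\mathcal{R}$. If $(\mathcal{L},\mathcal{R})$ is an orthogonal factorisation system, i.e. diagonal fillers are unique, then the fibration $\mathrm{cod}{\restriction}_{\mathcal{R}}:\mathcal{R}\to\mathcal{C}$ is elementary.
   Context: A weak factorisation system on $\mathcal{C}$ consists of two classes of arrows $\mathcal{L}$, $\mathcal{R}$, both containing all isomorphisms and closed under retracts, such that every arrow of $\mathcal{C}$ factors as an arrow in $\mathcal{L}$ followed by an arrow in $\mathcal{R}$, and every commutative square with left side $l\in\mathcal{L}$ and right side $r\in\mathcal{R}$ has a (not necessarily unique) diagonal filler making both triangles commute. $\mathcal{R}$ is regarded as the full subcategory of the arrow category $\mathcal{C}^{\mathbf 2}$ on the arrows in $\mathcal{R}$; $\mathrm{cod}{\restriction}_{\mathcal{R}}$ sends an arrow to its codomain. Since $\mathcal{R}$ is stable under pullback, it is a fibration (cartesian arrows are pullback squares) with finite products (given in the fibres by pullbacks). A fibration with finite products $p:\mathcal{E}\to\mathcal{B}$ ($\mathcal{B}$ and all fibres have finite products, denoted $\wedge$ in fibres, preserved by reindexing $f^*$) is *elementary* if for all $Y,X$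 in $\mathcal{B}$ reindexing along the parametrised diagonal $\mathrm{pr}_{1,2,2}=\langle\mathrm{pr}_1,\mathrm{pr}_2,\mathrm{pr}_2\rangle:Y\times X\to Y\times X\times X$ has a left adjoint $\exists_{Y,X}:\mathcal{E}_{Y\times X}\to\mathcal{E}_{Y\times X\times X}$ and these satisfy: (Frobenius Reciprocity) for every $A$ over $Y\times X$ and $B$ over $Y\times X\times X$ the canonical arrow $\exists_{Y,X}(\mathrm{pr}_{1,2,2}^*B\wedge A)\to B\wedge\exists_{Y,X}A$ is iso; (Beck-Chevalley Condition) for every $f:Y\to Z$ and every $A$ over $Z\times X$ the canonical arrow $\exists_{Y,X}(f\times X)^*A\to(f\times X\times X)^*\exists_{Z,X}A$ is iso. *)

(* Defs.v *)
From Stdlib Require Import ssreflect ProofIrrelevance.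

Set Implicit Arguments.
Unset Strict Implicit.
Unset Printing Implicit Defensive.

Declare Scope cat_scope.
Delimit Scope cat_scope with cat.
Local Open Scope cat_scope.

Record category := Category {
  obj :> Type;
  hom : obj -> obj -> Type;
  idc : forall X, hom X X;
  comp : forall X Y Z, hom Y Z -> hom X Y -> hom X Z;
  comp_id_l : forall X Y (f : hom X Y), comp (idc Y) f = f;
  comp_id_r : forall X Y (f : hom X Y), comp f (idc X) = f;
  comp_assoc : forall W X Y Z (h : hom Y Z) (g : hom X Y) (f : hom W X),
    comp h (comp g f) = comp (comp h g) f
}.

Notation "g ∘ f" := (comp g f) (at level 40, left associativity) : cat_scope.

Definition is_iso (C : category) (X Y : C) (f : hom X Y) : Prop :=
  exists g : hom Y X, g ∘ f = idc X /\ f ∘ g = idc Y.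

Record functor (C D : category) := Functor {
  fobj :> C -> D;
  fmap : forall X Y : C, hom X Y -> hom (fobj X) (fobj Y);
  fmap_id : forall X : C, fmap (idc X) = idc (fobj X);
  fmap_comp : forall (X Y Z : C) (g : hom Y Z) (f : hom X Y),
    fmap (g ∘ f) = fmap g ∘ fmap f
}.

Record adjunction (C D : category) (F : functor C D) (G : functor D C) := Adjunction {
  adj_unit : forall X : C, hom X (G (F X));
  adj_counit : forall Y : D, hom (F (G Y)) Y;
  adj_unit_nat : forall (X X' : C) (f : hom X X'),
    fmap G (fmap F f) ∘ adj_unit X = adj_unit X' ∘ f;
  adj_counit_nat : forall (Y Y' : D) (g : hom Y Y'),
    g ∘ adj_counit Y = adj_counit Y' ∘ fmap F (fmap G g);
  adj_triangle_l : forall X : C,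
    adj_counit (F X) ∘ fmap F (adj_unit X) = idc (F X);
  adj_triangle_r : forall Y : D,
    fmap G (adj_counit Y) ∘ adj_unit (G Y) = idc (G Y)
}.

Definition is_terminal (C : category) (T : C) : Prop :=
  forall X : C, exists! f : hom X T, True.

Definition is_product (C : category) (X Y P : C) (p : hom P X) (q : hom P Y) : Prop :=
  forall (Z : C) (f : hom Z X) (g : hom Z Y),
    exists! h : hom Z P, p ∘ h = f /\ q ∘ h = g.

Record finite_products (C : category) := FiniteProducts {
  one : C;
  bang : forall X : C, hom X one;
  bang_uniq : forall (X : C) (f : hom X one), f = bang X;
  bprod : C -> C -> C;
  pr1 : forall X Y : C, hom (bprod X Y) X;
  pr2 : forall X Y : C, hom (bprod X Y) Y;
  pairing : forall Z X Y : C, hom Z X -> hom Z Y -> hom Z (bprod X Y);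
  pairing_pr1 : forall (Z X Y : C) (f : hom Z X) (g : hom Z Y),
    pr1 X Y ∘ pairing f g = f;
  pairing_pr2 : forall (Z X Y : C) (f : hom Z X) (g : hom Z Y),
    pr2 X Y ∘ pairing f g = g;
  pairing_uniq : forall (Z X Y : C) (f : hom Z X) (g : hom Z Y) (h : hom Z (bprod X Y)),
    pr1 X Y ∘ h = f -> pr2 X Y ∘ h = g -> h = pairing f g
}.

Arguments pr1 {C} _ {X Y}.
Arguments pr2 {C} _ {X Y}.

Definition preserves_finite_products (C D : category) (PC : finite_products C)
    (F : functor C D) : Prop :=
  is_terminal (F (one PC)) /\
  forall X Y : C, is_product (fmap F (pr1 PC (X := X) (Y := Y))) (fmap F (pr2 PC)).

Definition times_map (C : category) (P : finite_products C) (Y Z : C)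
    (f : hom Y Z) (X : C) : hom (bprod P Y X) (bprod P Z X) :=
  pairing P (f ∘ pr1 P) (pr2 P).

(* The parametrised diagonal pr_{1,2,2}, with Y × X × X read as (Y × X) × X. *)
Definition pdiag (C : category) (P : finite_products C) (Y X : C) :
    hom (bprod P Y X) (bprod P (bprod P Y X) X) :=
  pairing P (pairing P (pr1 P) (pr2 P)) (pr2 P).

Lemma pairing_comp (C : category) (P : finite_products C) (W Z X Y : C)
    (f : hom Z X) (g : hom Z Y) (h : hom W Z) :
  pairing P f g ∘ h = pairing P (f ∘ h) (g ∘ h).
Proof.
by apply: pairing_uniq; rewrite comp_assoc ?pairing_pr1 ?pairing_pr2.
Qed.

Lemma pdiag_nat (C : category) (P : finite_products C) (Y Z X : C) (f : hom Y Z) :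
  pdiag P Z X ∘ times_map P f X =
  times_map P (times_map P f X) X ∘ pdiag P Y X.
Proof.
by rewrite /pdiag /times_map !pairing_comp -!comp_assoc
  ?(pairing_pr1, pairing_pr2).
Qed.

(* The square with top q : W -> Y, left p : W -> X, bottom f, right g. *)
Definition is_pullback (C : category) (W X Y Z : C) (p : hom W X) (q : hom W Y)
    (f : hom X Z) (g : hom Y Z) : Prop :=
  f ∘ p = g ∘ q /\
  forall (V : C) (a : hom V X) (b : hom V Y), f ∘ a = g ∘ b ->
    exists! h : hom V W, p ∘ h = a /\ q ∘ h = b.

Definition arrow_class (C : category) := forall X Y : C, hom X Y -> Prop.

Definition is_retract (C : category) (A B X Y : C) (f : hom A B) (g : hom X Y) : Prop :=
  exists (s : hom A X) (r : hom X A) (s' : hom B Y) (r' : hom Y B),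
    r ∘ s = idc A /\ r' ∘ s' = idc B /\ g ∘ s = s' ∘ f /\ f ∘ r = r' ∘ g.

Definition is_filler (C : category) (A B X Y : C) (l : hom A B) (r : hom X Y)
    (u : hom A X) (v : hom B Y) (d : hom B X) : Prop :=
  d ∘ l = u /\ r ∘ d = v.

Record weak_factorisation_system (C : category) (L R : arrow_class C) : Prop := WFS {
  wfs_iso_l : forall (X Y : C) (f : hom X Y), is_iso f -> L X Y f;
  wfs_iso_r : forall (X Y : C) (f : hom X Y), is_iso f -> R X Y f;
  wfs_retract_l : forall (A B X Y : C) (f : hom A B) (g : hom X Y),
    is_retract f g -> L X Y g -> L A B f;
  wfs_retract_r : forall (A B X Y : C) (f : hom A B) (g : hom X Y),
    is_retract f g -> R X Y g -> R A B f;
  wfs_factor : forall (X Y : C) (f : hom X Y),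
    exists (M : C) (l : hom X M) (r : hom M Y), L X M l /\ R M Y r /\ r ∘ l = f;
  wfs_filler : forall (A B X Y : C) (l : hom A B) (r : hom X Y)
      (u : hom A X) (v : hom B Y),
    L A B l -> R X Y r -> r ∘ u = v ∘ l -> exists d : hom B X, is_filler l r u v d
}.

Definition unique_fillers (C : category) (L R : arrow_class C) : Prop :=
  forall (A B X Y : C) (l : hom A B) (r : hom X Y) (u : hom A X) (v : hom B Y),
    L A B l -> R X Y r -> r ∘ u = v ∘ l ->
    forall d d' : hom B X, is_filler l r u v d -> is_filler l r u v d' -> d = d'.

Definition has_pullbacks_of (C : category) (R : arrow_class C) : Prop :=
  forall (X Y Z : C) (f : hom X Z) (r : hom Y Z), R Y Z r ->
    exists (W : C) (p : hom W X) (q : hom W Y), is_pullback p q f r.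

Definition closed_under_products (C : category) (P : finite_products C)
    (L : arrow_class C) : Prop :=
  forall (Y Z : C) (l : hom Y Z) (X : C),
    L Y Z l -> L (bprod P Y X) (bprod P Z X) (times_map P l X).

Definition closed_under_pullback_along (C : category) (L R : arrow_class C) : Prop :=
  forall (W X Y Z : C) (p : hom W X) (q : hom W Y) (r : hom X Z) (l : hom Y Z),
    is_pullback p q r l -> R X Z r -> L Y Z l -> L W X p.

Lemma sig_val_inj (T : Type) (P : T -> Prop) (a b : {x | P x}) :
  proj1_sig a = proj1_sig b -> a = b.
Proof.
case: a b => [a Pa] [b Pb] /= e; subst b.
by rewrite (proof_irrelevance _ Pa Pb).
Qed.

Record arrow (C : category) := Arrow {
  arr_dom : C;
  arr_cod : C;
  arr_map : hom arr_dom arr_cod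
}.

Section ArrowCategory.
Variable C : category.

Definition square (a b : arrow C) : Type :=
  {t : hom (arr_dom a) (arr_dom b) * hom (arr_cod a) (arr_cod b) |
     arr_map b ∘ fst t = snd t ∘ arr_map a}.

Program Definition square_id (a : arrow C) : square a a :=
  exist _ (idc (arr_dom a), idc (arr_cod a)) _.
Next Obligation. by move=> a; rewrite /= comp_id_l comp_id_r. Qed.

Program Definition square_comp (a b c : arrow C) (t : square b c) (s : square a b) :
    square a c :=
  exist _ (fst (proj1_sig t) ∘ fst (proj1_sig s),
           snd (proj1_sig t) ∘ snd (proj1_sig s)) _.
Next Obligation.
move=> a b c [t et] [s es] /=.
by rewrite comp_assoc et -comp_assoc es comp_assoc.
Qed.

Program Definition arrow_category : category :=
  {| obj := arrow C; hom := square; idc := square_id; comp := square_comp |}.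
Next Obligation.
by move=> a b [[s s'] es]; apply: sig_val_inj; rewrite /= !comp_id_l.
Qed.
Next Obligation.
by move=> a b [[s s'] es]; apply: sig_val_inj; rewrite /= !comp_id_r.
Qed.
Next Obligation.
by move=> a b c d u t s; apply: sig_val_inj; rewrite /= !comp_assoc.
Qed.

Program Definition cod : functor arrow_category C :=
  {| fobj := @arr_cod C; fmap := fun a b (t : square a b) => snd (proj1_sig t) |}.
Next Obligation. by []. Qed.
Next Obligation. by []. Qed.

End ArrowCategory.

Definition full_subcategory (C : category) (P : C -> Prop) : category := {|
  obj := {X : C | P X};
  hom := fun X Y => hom (proj1_sig X) (proj1_sig Y);
  idc := fun X => idc (proj1_sig X);
  comp := fun X Y Z g f => g ∘ f;
  comp_id_l := fun X Y f => comp_id_l f;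
  comp_id_r := fun X Y f => comp_id_r f;
  comp_assoc := fun W X Y Z h g f => comp_assoc h g f
|}.

Definition restrict_functor (C D : category) (F : functor C D) (P : C -> Prop) :
    functor (full_subcategory P) D :=
  @Functor (full_subcategory P) D
    (fun X => F (proj1_sig X))
    (fun X Y f => fmap F f)
    (fun X => fmap_id F (proj1_sig X))
    (fun X Y Z g f => fmap_comp F g f).

Definition in_class (C : category) (R : arrow_class C) (a : arrow_category C) : Prop :=
  R (arr_dom a) (arr_cod a) (arr_map a).

Definition cod_restr (C : category) (R : arrow_class C) :
    functor (full_subcategory (in_class R)) C :=
  restrict_functor (cod C) (in_class R).

Definition eq_to_hom (C : category) (X Y : C) (e : X = Y) : hom X Y :=
  match e in _ = Y' return hom X Y' with eq_refl => idc X end.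

Section Fibres.
Variables (E B : category) (p : functor E B).

Definition over_obj (X : B) : Type := {A : E | p A = X}.

(* p φ = u, up to the identifications p A = X and p A' = Y. *)
Definition is_over (X Y : B) (u : hom X Y) (A : over_obj X) (A' : over_obj Y)
    (φ : hom (proj1_sig A) (proj1_sig A')) : Prop :=
  eq_to_hom (proj2_sig A') ∘ fmap p φ = u ∘ eq_to_hom (proj2_sig A).

Definition over_hom (X Y : B) (u : hom X Y) (A : over_obj X) (A' : over_obj Y) : Type :=
  {φ : hom (proj1_sig A) (proj1_sig A') | is_over u φ}.

Program Definition over_id (X : B) (A : over_obj X) : over_hom (idc X) A A :=
  exist _ (idc (proj1_sig A)) _.
Next Obligation.
by move=> X A; rewrite /is_over fmap_id comp_id_l comp_id_r.
Qed.

Program Definition over_comp (X Y Z : B) (v : hom Y Z) (u : hom X Y)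
    (A : over_obj X) (A' : over_obj Y) (A'' : over_obj Z)
    (ψ : over_hom v A' A'') (φ : over_hom u A A') : over_hom (v ∘ u) A A'' :=
  exist _ (proj1_sig ψ ∘ proj1_sig φ) _.
Next Obligation.
move=> X Y Z v u A A' A'' [ψ eψ] [φ eφ]; rewrite /is_over /=.
by rewrite fmap_comp comp_assoc eψ -comp_assoc eφ comp_assoc.
Qed.

Definition over_cast (X Y : B) (u v : hom X Y) (e : u = v) (A : over_obj X)
    (A' : over_obj Y) (φ : over_hom u A A') : over_hom v A A' :=
  exist _ (proj1_sig φ)
    (match e in _ = w return is_over w (proj1_sig φ) with eq_refl => proj2_sig φ end).

Program Definition fibre (X : B) : category := {|
  obj := over_obj X;
  hom := over_hom (idc X);
  idc := @over_id X;
  comp := fun A A' A'' ψ φ => over_cast (comp_id_l (idc X)) (over_comp ψ φ)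
|}.
Next Obligation. by move=> X A A' φ; apply: sig_val_inj; rewrite /= comp_id_l. Qed.
Next Obligation. by move=> X A A' φ; apply: sig_val_inj; rewrite /= comp_id_r. Qed.
Next Obligation.
by move=> X A A' A'' A''' χ ψ φ; apply: sig_val_inj; rewrite /= comp_assoc.
Qed.

Record cartesian (X Y : B) (u : hom X Y) (A : over_obj X) (A' : over_obj Y)
    (φ : over_hom u A A') := Cartesian {
  cart_factor : forall (W : B) (w : hom W X) (D : over_obj W),
    over_hom (u ∘ w) D A' -> over_hom w D A;
  cart_factorK : forall (W : B) (w : hom W X) (D : over_obj W)
      (ψ : over_hom (u ∘ w) D A'),
    over_comp φ (cart_factor ψ) = ψ;
  cart_uniq : forall (W : B) (w : hom W X) (D : over_obj W)
      (ψ : over_hom (u ∘ w) D A') (χ : over_hom w D A),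
    over_comp φ χ = ψ -> χ = cart_factor ψ
}.

(* A fibration is a functor with enough cartesian lifts; reindexing is taken
   with respect to a choice of such lifts. *)
Record cleavage := Cleavage {
  pull : forall (X Y : B), hom X Y -> fibre Y -> fibre X;
  lift : forall (X Y : B) (u : hom X Y) (A : fibre Y), over_hom u (pull u A) A;
  lift_cart : forall (X Y : B) (u : hom X Y) (A : fibre Y), cartesian (lift u A)
}.

Section Reindexing.
Variable c : cleavage.

Definition factor (W X Y : B) (u : hom X Y) (A : fibre Y) (w : hom W X) (D : fibre W)
    (ψ : over_hom (u ∘ w) D A) : over_hom w D (pull c u A) :=
  cart_factor (lift_cart c u A) ψ.

Lemma factorK (W X Y : B) (u : hom X Y) (A : fibre Y) (w : hom W X) (D : fibre W)
    (ψ : over_hom (u ∘ w) D A) :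
  proj1_sig (lift c u A) ∘ proj1_sig (factor ψ) = proj1_sig ψ.
Proof. exact: (f_equal (@proj1_sig _ _) (cart_factorK (lift_cart c u A) ψ)). Qed.

Lemma factor_uniq (W X Y : B) (u : hom X Y) (A : fibre Y) (w : hom W X) (D : fibre W)
    (ψ : over_hom (u ∘ w) D A) (χ : over_hom w D (pull c u A)) :
  proj1_sig (lift c u A) ∘ proj1_sig χ = proj1_sig ψ -> χ = factor ψ.
Proof. by move=> e; apply: cart_uniq; apply: sig_val_inj. Qed.

Lemma reindex_eq (X Y : B) (u : hom X Y) : idc Y ∘ u = u ∘ idc X.
Proof. by rewrite comp_id_l comp_id_r. Qed.

Definition reindex_map (X Y : B) (u : hom X Y) (A A' : fibre Y) (φ : hom A A') :
    @hom (fibre X) (pull c u A) (pull c u A') :=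
  factor (over_cast (reindex_eq u) (over_comp φ (lift c u A))).

Program Definition reindex (X Y : B) (u : hom X Y) : functor (fibre Y) (fibre X) :=
  {| fobj := pull c u; fmap := @reindex_map X Y u |}.
Next Obligation.
by move=> X Y u A; symmetry; apply: factor_uniq; rewrite /= comp_id_l comp_id_r.
Qed.
Next Obligation.
move=> X Y u A A' A'' ψ φ; symmetry; apply: factor_uniq.
by rewrite /= comp_assoc factorK /= -comp_assoc factorK /= comp_assoc.
Qed.

(* The canonical comparison u^* v^* D -> u'^* v'^* D over a commuting square. *)
Lemma exchange_eq (W X X' Z : B) (u : hom W X) (v : hom X Z) (u' : hom W X')
    (v' : hom X' Z) : v ∘ u = v' ∘ u' -> v ∘ u = v' ∘ (u' ∘ idc W).
Proof. by rewrite comp_id_r. Qed.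

Definition exchange (W X X' Z : B) (u : hom W X) (v : hom X Z) (u' : hom W X')
    (v' : hom X' Z) (e : v ∘ u = v' ∘ u') (D : fibre Z) :
    @hom (fibre W) (reindex u (reindex v D)) (reindex u' (reindex v' D)) :=
  factor (factor (over_cast (exchange_eq e)
    (over_comp (lift c v D) (lift c u (pull c v D))))).

End Reindexing.
End Fibres.

Record fibration_with_products (E B : category) (p : functor E B) := FibrationWithProducts {
  fib_cleavage :> cleavage p;
  fib_prod : forall X : B, finite_products (fibre p X);
  fib_prod_pres : forall (X Y : B) (u : hom X Y),
    preserves_finite_products (fib_prod Y) (reindex fib_cleavage u)
}.

Section Elementary.
Variables (E B : category) (p : functor E B) (P : finite_products B).
Variable F : fibration_with_products p.

Definition diag_exists :=
  forall Y X : B, functor (fibre p (bprod P Y X)) (fibre p (bprod P (bprod P Y X) X)).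

Definition diag_adjunction (Ex : diag_exists) :=
  forall Y X : B, adjunction (Ex Y X) (reindex F (pdiag P Y X)).

Variables (Ex : diag_exists) (adj : diag_adjunction Ex).

Definition frobenius_arrow (Y X : B) (A : fibre p (bprod P Y X))
    (D : fibre p (bprod P (bprod P Y X) X)) :
    hom (Ex Y X (bprod (fib_prod F _) (reindex F (pdiag P Y X) D) A))
        (bprod (fib_prod F _) D (Ex Y X A)) :=
  pairing (fib_prod F _)
    (adj_counit (adj Y X) D ∘ fmap (Ex Y X) (pr1 (fib_prod F _)))
    (fmap (Ex Y X) (pr2 (fib_prod F _))).

(* The transpose of
   (f×X)^* A -> (f×X)^* pr_{1,2,2}^* ∃ A ≅ pr_{1,2,2}^* (f×X×X)^* ∃ A. *)
Definition beck_chevalley_arrow (Y Z X : B) (f : hom Y Z) (A : fibre p (bprod P Z X)) :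
    hom (Ex Y X (reindex F (times_map P f X) A))
        (reindex F (times_map P (times_map P f X) X) (Ex Z X A)) :=
  adj_counit (adj Y X) _ ∘
  fmap (Ex Y X) (exchange F (pdiag_nat P X f) (Ex Z X A) ∘
                 fmap (reindex F (times_map P f X)) (adj_unit (adj Z X) A)).

Definition frobenius_reciprocity : Prop :=
  forall (Y X : B) (A : fibre p (bprod P Y X)) (D : fibre p (bprod P (bprod P Y X) X)),
    is_iso (frobenius_arrow A D).

Definition beck_chevalley : Prop :=
  forall (Y Z X : B) (f : hom Y Z) (A : fibre p (bprod P Z X)),
    is_iso (beck_chevalley_arrow f A).

End Elementary.

Definition elementary_structure (E B : category) (p : functor E B) (P : finite_products B)
    (F : fibration_with_products p) : Prop :=
  exists (Ex : diag_exists p P) (adj : diag_adjunction F Ex),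
    frobenius_reciprocity adj /\ beck_chevalley adj.

(* Cartesian lifts and fibrewise products are only determined up to isomorphism:
   we ask that some choice of them exists, and that the conditions hold for
   every choice. *)
Definition elementary (E B : category) (p : functor E B) (P : finite_products B) : Prop :=
  inhabited (fibration_with_products p) /\
  forall F : fibration_with_products p, elementary_structure P F.

(* Main.v *)
(** Orthogonality makes every arrow of the fibration whose top is in [L]
    opcartesian, so the left adjoint to reindexing along [u] sends [A] to the
    [R]-part of [u ∘ A], and a comparison arrow out of it is invertible as soon
    as its composite with the [L]-part is again in [L].  For Frobenius
    reciprocity this composite is a pullback of the [L]-part of [pdiag ∘ A]
    along a projection in [R].  For Beck-Chevalley, factor the diagonal of [X]
    through [I] with [X -> I] in [L] and [I -> X × X] in [R]: then
    [A -> A ×_X I -> Y × X × X] is a factorisation of [pdiag ∘ A], its first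
    arrow being a pullback of [(X -> I) × Y] along an arrow of [R], and it is
    stable under base change along any [f × X × X]. *)

From Stdlib Require Import ssreflect IndefiniteDescription.
Require Import Defs.

Set Implicit Arguments.
Unset Strict Implicit.
Unset Printing Implicit Defensive.

Local Open Scope cat_scope.

(** * Cancellation and lifting for products and pullbacks *)

Lemma bprod_ext (C : category) (P : finite_products C) (Z X Y : C)
    (h h' : hom Z (bprod P X Y)) :
  pr1 P ∘ h = pr1 P ∘ h' -> pr2 P ∘ h = pr2 P ∘ h' -> h = h'.
Proof. by move=> e1 e2; rewrite (pairing_uniq e1 e2) -(pairing_uniq eq_refl eq_refl). Qed.

Lemma pullback_lift (C : category) (W X Y Z : C) (p : hom W X) (q : hom W Y)
    (f : hom X Z) (g : hom Y Z) (V : C) (a : hom V X) (b : hom V Y) :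
  is_pullback p q f g -> f ∘ a = g ∘ b -> exists h, p ∘ h = a /\ q ∘ h = b.
Proof. by move=> [_ u] /u [h [e _]]; exists h. Qed.

Lemma pullback_ext (C : category) (W X Y Z : C) (p : hom W X) (q : hom W Y)
    (f : hom X Z) (g : hom Y Z) (V : C) (h h' : hom V W) :
  is_pullback p q f g -> p ∘ h = p ∘ h' -> q ∘ h = q ∘ h' -> h = h'.
Proof.
move=> [e u] ep eq.
have [|k [_ uk]] := u V (p ∘ h') (q ∘ h'); first by rewrite !comp_assoc e.
by rewrite -(uk h) // -(uk h').
Qed.

Lemma is_pullback_intro (C : category) (W X Y Z : C) (p : hom W X) (q : hom W Y)
    (f : hom X Z) (g : hom Y Z) :
  f ∘ p = g ∘ q ->
  (forall (V : C) (a : hom V X) (b : hom V Y), f ∘ a = g ∘ b ->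
    exists h, p ∘ h = a /\ q ∘ h = b) ->
  (forall (V : C) (h h' : hom V W), p ∘ h = p ∘ h' -> q ∘ h = q ∘ h' -> h = h') ->
  is_pullback p q f g.
Proof.
move=> e ex un; split=> // V a b /ex [h [ea eb]].
by exists h; split=> // h' [ea' eb']; apply: un; rewrite ?ea ?eb.
Qed.

Lemma pullback_sym (C : category) (W X Y Z : C) (p : hom W X) (q : hom W Y)
    (f : hom X Z) (g : hom Y Z) :
  is_pullback p q f g -> is_pullback q p g f.
Proof.
move=> pb; apply: is_pullback_intro => [|V x y e|V h h' e1 e2].
- by rewrite (proj1 pb).
- by have [h [h1 h2]] := pullback_lift pb (eq_sym e); exists h.
- exact: (pullback_ext pb).
Qed.

(** * Closure properties of the right class and uniqueness of factorisations *)

Section OrthogonalFactorisation.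
Variables (C : category) (L R : arrow_class C).
Hypothesis wfs : weak_factorisation_system L R.

(** Retract argument: factor [r] as [r' ∘ l]; a filler of the square with the identity on top and
    [r'] below exhibits [r] as a retract of [r']. *)
Lemma right_class_of_filler (X Y : C) (r : hom X Y) :
  (forall (A B : C) (l : hom A B) (u : hom A X) (v : hom B Y),
     L l -> r ∘ u = v ∘ l -> exists d, is_filler l r u v d) -> R r.
Proof.
move=> fill; have [M [l [r' [Ll [Rr' e]]]]] := wfs_factor wfs r.
have [|d [dl rd]] := fill _ _ l (idc X) r' Ll; first by rewrite comp_id_r e.
apply: (wfs_retract_r wfs (g := r')) => //.
by exists l, d, (idc Y), (idc Y); rewrite !comp_id_l.
Qed.

Lemma right_class_comp (X Y Z : C) (g : hom Y Z) (f : hom X Y) :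
  R f -> R g -> R (g ∘ f).
Proof.
move=> Rf Rg; apply: right_class_of_filler => A B l u v Ll e.
have [|d [dl gd]] := wfs_filler wfs (u := f ∘ u) (v := v) Ll Rg.
  by rewrite comp_assoc.
have [|d' [dl' fd']] := wfs_filler wfs (u := u) (v := d) Ll Rf; first by [].
by exists d'; split=> //; rewrite -comp_assoc fd'.
Qed.

Lemma right_class_pullback (W X Y Z : C) (p : hom W X) (q : hom W Y)
    (f : hom X Z) (r : hom Y Z) :
  is_pullback p q f r -> R r -> R p.
Proof.
move=> pb Rr; apply: right_class_of_filler => A B l u v Ll e.
have [|d [dl rd]] := wfs_filler wfs (u := q ∘ u) (v := f ∘ v) Ll Rr.
  by rewrite comp_assoc -(proj1 pb) -!comp_assoc e.
have [|h [ph qh]] := pullback_lift (a := v) (b := d) pb; first by [].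
exists h; split=> //.
by apply: (pullback_ext pb); rewrite comp_assoc ?ph ?qh.
Qed.

Lemma right_class_id (X : C) : R (idc X).
Proof. by apply: (wfs_iso_r wfs); exists (idc X); rewrite comp_id_l. Qed.

Hypothesis orthogonal : unique_fillers L R.

(** Both arrows fill the square with top [d ∘ l] and bottom [r ∘ d]. This is the form in which
    orthogonality is used throughout. *)
Lemma left_class_epi (A B X Y : C) (l : hom A B) (r : hom X Y) (d d' : hom B X) :
  L l -> R r -> r ∘ d = r ∘ d' -> d ∘ l = d' ∘ l -> d = d'.
Proof.
move=> Ll Rr er el.
by apply: (orthogonal (u := d ∘ l) (v := r ∘ d) Ll Rr); rewrite ?comp_assoc //; split.
Qed.

(** The inverse of [χ] is the filler of the square formed by [χ ∘ l] and [r]; both composites are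
    identities by [left_class_epi]. *)
Lemma factorisation_uniq (A M N Y : C) (l : hom A M) (r : hom M Y) (r' : hom N Y)
    (χ : hom M N) :
  L l -> R r -> L (χ ∘ l) -> R r' -> r' ∘ χ = r ->
  exists χ' : hom N M, r ∘ χ' = r' /\ χ' ∘ χ = idc M /\ χ ∘ χ' = idc N.
Proof.
move=> Ll Rr Lχl Rr' e.
have [|d [dl rd]] := wfs_filler wfs (u := l) (v := r') Lχl Rr.
  by rewrite comp_assoc e.
exists d; split=> //; split.
  apply: (left_class_epi Ll Rr); first by rewrite comp_assoc rd e comp_id_r.
  by rewrite -comp_assoc dl comp_id_l.
apply: (left_class_epi Lχl Rr'); first by rewrite comp_assoc e rd comp_id_r.
by rewrite -comp_assoc dl comp_id_l.
Qed.

End OrthogonalFactorisation.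

(** * A factorisation of the parametrised diagonal stable under base change *)

Section StableFactorisation.
Variables (C : category) (P : finite_products C) (L R : arrow_class C).
Hypothesis wfs : weak_factorisation_system L R.
Hypothesis pullbacks : has_pullbacks_of R.
Hypothesis L_products : closed_under_products P L.
Hypothesis L_pullbacks : closed_under_pullback_along L R.

Section Path.
(* [I] is a path object of [X]: [ι] gives constant paths, [s] and [t] endpoints. *)
Variables (X I : C) (ι : hom X I) (s t : hom I X).
Hypotheses (Rst : R (pairing P s t)) (Lι : L ι) (sι : s ∘ ι = idc X).

Variables (Y A E : C) (a : hom A (bprod P Y X)) (α : hom E A) (q : hom E I).
Hypotheses (Ra : R a) (pb : is_pullback α q (pr2 P ∘ a) s).

(** The arrow is a composite [E -> A × X -> (Y × X) × X]. The first arrow is a pullback of [⟨s, t⟩]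
    along [(pr2 ∘ a) × X], the second is [a × X], a pullback of [a] along a projection. *)
Lemma path_right_class : R (pairing P (a ∘ α) (t ∘ q)).
Proof.
have ->: pairing P (a ∘ α) (t ∘ q) = times_map P a X ∘ pairing P α (t ∘ q).
  by rewrite /times_map pairing_comp -comp_assoc pairing_pr1 pairing_pr2.
apply: (right_class_comp wfs).
- apply: (right_class_pullback wfs (q := q) (f := times_map P (pr2 P ∘ a) X)
            (r := pairing P s t)) => //.
  apply: is_pullback_intro => [|V x y e|V h h' e1 e2].
  + by rewrite /times_map !pairing_comp -comp_assoc pairing_pr1 pairing_pr2 (proj1 pb).
  + have e1 := f_equal (fun z => pr1 P ∘ z) e; have e2 := f_equal (fun z => pr2 P ∘ z) e.
    move: e1 e2; rewrite /= /times_map !pairing_comp !pairing_pr1 !pairing_pr2 => e1 e2.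
    have [|h [hα hq]] := pullback_lift (a := pr1 P ∘ x) (b := y) pb.
      by rewrite -e1 !comp_assoc.
    exists h; split=> //; apply: (@bprod_ext _ P).
      by rewrite comp_assoc pairing_pr1.
    by rewrite comp_assoc pairing_pr2 -comp_assoc hq e2.
  + apply: (pullback_ext pb) => //.
    by have := f_equal (fun z => pr1 P ∘ z) e1; rewrite /= !comp_assoc pairing_pr1.
- apply: (right_class_pullback wfs (q := pr1 P) (f := pr1 P) (r := a)) => //.
  apply: is_pullback_intro => [|V x y e|V h h' e1 e2].
  + by rewrite pairing_pr1.
  + exists (pairing P y (pr2 P ∘ x)); split; last by rewrite pairing_pr1.
    apply: (@bprod_ext _ P).
      by rewrite comp_assoc pairing_pr1 -comp_assoc pairing_pr1.
    by rewrite comp_assoc !pairing_pr2.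
  + apply: (@bprod_ext _ P) => //.
    by have := f_equal (fun z => pr2 P ∘ z) e1; rewrite /= !comp_assoc pairing_pr2.
Qed.

(** [φ] is the pullback of [ι × Y] along [⟨q, pr1 ∘ a ∘ α⟩ : E -> I × Y], and the latter is in [R]
    as the pullback of [a] along [⟨pr2, s ∘ pr1⟩ : I × Y -> Y × X]. *)
Lemma path_left_class (φ : hom A E) :
  α ∘ φ = idc A -> q ∘ φ = ι ∘ (pr2 P ∘ a) -> L φ.
Proof.
move=> αφ qφ.
have e0 : pr2 P ∘ (a ∘ α) = s ∘ q by rewrite comp_assoc (proj1 pb).
apply: (L_pullbacks (q := pairing P (pr2 P ∘ a) (pr1 P ∘ a))
          (r := pairing P q (pr1 P ∘ (a ∘ α))) (l := times_map P ι Y));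
  last exact: L_products.
- apply: is_pullback_intro => [|V x y e|V h h' e1 e2].
  + rewrite /times_map !pairing_comp -!comp_assoc pairing_pr1 pairing_pr2 qφ.
    by rewrite αφ comp_id_r.
  + have e1 := f_equal (fun z => pr1 P ∘ z) e; have e2 := f_equal (fun z => pr2 P ∘ z) e.
    move: e1 e2; rewrite /= /times_map !pairing_comp !pairing_pr1 !pairing_pr2 => e1 e2.
    (* Apply [s] to [e1] and use that [s] retracts [ι]. *)
    have e3 : pr2 P ∘ a ∘ (α ∘ x) = pr1 P ∘ y.
      rewrite comp_assoc (proj1 pb) -comp_assoc e1 2!comp_assoc sι.
      by rewrite comp_id_l.
    (* The only possible lift, because [α ∘ φ] is the identity. *)
    exists (α ∘ x); split.
      apply: (pullback_ext pb).
        by rewrite comp_assoc αφ comp_id_l.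
      by rewrite comp_assoc qφ -comp_assoc e3 e1 comp_assoc.
    rewrite pairing_comp e3; symmetry; apply: pairing_uniq => //.
    by rewrite -e2 !comp_assoc.
  + by have := f_equal (fun z => α ∘ z) e1; rewrite /= !comp_assoc αφ !comp_id_l.
- apply: (right_class_pullback wfs (q := α)
            (f := pairing P (pr2 P) (s ∘ pr1 P)) (r := a)) => //.
  apply: is_pullback_intro => [|V x y e|V h h' e1 e2].
  + apply: (@bprod_ext _ P); rewrite !comp_assoc ?pairing_pr1 ?pairing_pr2.
      by [].
    by rewrite -comp_assoc pairing_pr1 -e0 !comp_assoc.
  + have e1 := f_equal (fun z => pr1 P ∘ z) e; have e2 := f_equal (fun z => pr2 P ∘ z) e.
    move: e1 e2; rewrite /= !pairing_comp !pairing_pr1 !pairing_pr2 => e1 e2.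
    have [|h [hα hq]] := pullback_lift (a := y) (b := pr1 P ∘ x) pb.
      by rewrite -comp_assoc -e2 comp_assoc.
    exists h; split=> //; apply: (@bprod_ext _ P).
      by rewrite comp_assoc pairing_pr1.
    by rewrite comp_assoc pairing_pr2 -!comp_assoc hα.
  + apply: (pullback_ext pb) => //.
    by have := f_equal (fun z => pr1 P ∘ z) e1; rewrite /= !comp_assoc pairing_pr1.
Qed.

End Path.

(** [k] is the arrow that [φ] induces between the base changes along [f × X] and [f × X × X].
    Quantifying over all pullback squares makes the property applicable to the lifts of any
    cleavage. *)
Definition stable_factorisation (Y X A E : C) (a : hom A (bprod P Y X))
    (e : hom E (bprod P (bprod P Y X) X)) (φ : hom A E) : Prop :=
  forall (Y' B B' : C) (f : hom Y' Y) (b : hom B (bprod P Y' X)) (g : hom B A)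
    (b' : hom B' (bprod P (bprod P Y' X) X)) (g' : hom B' E) (k : hom B B'),
  is_pullback b g (times_map P f X) a ->
  is_pullback b' g' (times_map P (times_map P f X) X) e ->
  b' ∘ k = pdiag P Y' X ∘ b -> g' ∘ k = φ ∘ g -> L k.

(* An arbitrary factorisation is only seen to be stable for [f] in [R], where
   [k] is a pullback of [φ] along an arrow of [R]; hence the choice of [A ×_X I]. *)
Lemma stable_factorisation_ex (Y X A : C) (a : hom A (bprod P Y X)) : R a ->
  exists (E : C) (e : hom E (bprod P (bprod P Y X) X)) (φ : hom A E),
    R e /\ L φ /\ e ∘ φ = pdiag P Y X ∘ a /\ stable_factorisation a e φ.
Proof.
move=> Ra.
have [I [ι [ρ [Lι [Rρ ρι]]]]] := wfs_factor wfs (pairing P (idc X) (idc X)).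
pose s := pr1 P ∘ ρ; pose t := pr2 P ∘ ρ.
have ρE : ρ = pairing P s t by apply: pairing_uniq.
have sι : s ∘ ι = idc X by rewrite /s -comp_assoc ρι pairing_pr1.
have tι : t ∘ ι = idc X by rewrite /t -comp_assoc ρι pairing_pr2.
rewrite {}ρE in Rρ; clearbody s t.
(* Only pullbacks of arrows in [R] are available, and [s] is not known to be in [R]. So [A ×_X I] is
   obtained by pulling back [⟨s, t⟩]; the extra coordinate of [β] is [t ∘ q], hence redundant. *)
have [E [β [q pbE]]] := pullbacks (times_map P (pr2 P ∘ a) X) Rρ.
pose α := pr1 P ∘ β.
have [e1 e2] : pr2 P ∘ a ∘ α = s ∘ q /\ pr2 P ∘ β = t ∘ q.
  have e := proj1 pbE; rewrite /times_map !pairing_comp in e.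
  split.
    by have := f_equal (fun z => pr1 P ∘ z) e; rewrite /= !pairing_pr1 -comp_assoc.
  by have := f_equal (fun z => pr2 P ∘ z) e; rewrite /= !pairing_pr2.
have pb : is_pullback α q (pr2 P ∘ a) s.
  apply: is_pullback_intro => [//|V x y e|V h h' eα eq].
    have [|h [hβ hq]] := pullback_lift (a := pairing P x (t ∘ y)) (b := y) pbE.
      rewrite /times_map !pairing_comp -!comp_assoc pairing_pr1 pairing_pr2.
      by rewrite comp_assoc e.
    by exists h; split=> //; rewrite /α -comp_assoc hβ pairing_pr1.
  apply: (pullback_ext pbE) => //.
  by apply: (@bprod_ext _ P); rewrite !comp_assoc // e2 -!comp_assoc eq.
(* [φ] pairs each point of [A] with the constant path at its [X]-coordinate. *)
clearbody α; have [|φ [αφ qφ]] := pullback_lift (a := idc A) (b := ι ∘ (pr2 P ∘ a)) pb.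
  by rewrite comp_id_r comp_assoc sι comp_id_l.
exists E, (pairing P (a ∘ α) (t ∘ q)), φ; split; last split; last split.
- exact: (path_right_class Rρ Ra pb).
- exact: (path_left_class Lι sι Ra pb αφ qφ).
- rewrite /pdiag !pairing_comp -!comp_assoc αφ qφ comp_id_r comp_assoc tι comp_id_l.
  by rewrite -(pairing_uniq (h := a) eq_refl eq_refl).
(* [B'] is again the path construction, now for [b]: it is a pullback of [s] along [pr2 ∘ b], so
   [path_left_class] applies to [k] directly. *)
- move=> Y' B B' f b g b' g' k pbB pbB' ek ek'.
  have Rb : R b := right_class_pullback wfs pbB Ra.
  have eb := proj1 pbB; have := proj1 pbB'; rewrite pairing_comp => eb'.
  have eb'1 : times_map P f X ∘ (pr1 P ∘ b') = a ∘ α ∘ g'.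
    have := f_equal (fun z => pr1 P ∘ z) eb'.
    by rewrite /= pairing_pr1 {1}/times_map comp_assoc pairing_pr1 -comp_assoc.
  have eb'2 : pr2 P ∘ b' = t ∘ q ∘ g'.
    have := f_equal (fun z => pr2 P ∘ z) eb'.
    by rewrite /= pairing_pr2 {1}/times_map comp_assoc pairing_pr2.
  have [|αB [bαB gαB]] := pullback_lift (a := pr1 P ∘ b') (b := α ∘ g') pbB.
    by rewrite eb'1 comp_assoc.
  (* Base change along [f × X] does not alter the [X]-coordinate. *)
  have pr2b : pr2 P ∘ b = pr2 P ∘ a ∘ g.
    by rewrite -comp_assoc -eb comp_assoc /times_map pairing_pr2.
  apply: (path_left_class (α := αB) (q := q ∘ g') Lι sι Rb).
  + apply: is_pullback_intro => [|V x y e|V h h' eα eq].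
    * by rewrite pr2b -comp_assoc gαB comp_assoc e1 comp_assoc.
    * have [|z [αz qz]] := pullback_lift (a := g ∘ x) (b := y) pb.
        by rewrite comp_assoc -pr2b.
      have [|h [b'h g'h]] := pullback_lift (a := pairing P (b ∘ x) (t ∘ y)) (b := z) pbB'.
        rewrite /times_map !pairing_comp -!comp_assoc !pairing_pr1 pairing_pr2 αz qz.
        by congr (pairing P _ _); rewrite [RHS]comp_assoc -eb !pairing_comp !comp_assoc.
      exists h; split; last by rewrite -comp_assoc g'h.
      apply: (pullback_ext pbB).
        by rewrite comp_assoc bαB -comp_assoc b'h pairing_pr1.
      by rewrite comp_assoc gαB -comp_assoc g'h.
    * have eq' : q ∘ (g' ∘ h) = q ∘ (g' ∘ h') by rewrite !comp_assoc.
      apply: (pullback_ext pbB').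
        apply: (@bprod_ext _ P); rewrite !comp_assoc.
          by rewrite -bαB -!comp_assoc eα.
        by rewrite eb'2 -!comp_assoc eq'.
      apply: (pullback_ext pb) => //.
      by rewrite !comp_assoc -gαB -!comp_assoc eα.
  + apply: (pullback_ext pbB).
      rewrite comp_assoc bαB -comp_assoc ek comp_assoc /pdiag pairing_pr1.
      by rewrite comp_id_r -(pairing_uniq (h := idc _)) ?comp_id_r ?comp_id_l.
    by rewrite comp_assoc gαB -comp_assoc ek' comp_assoc αφ comp_id_l comp_id_r.
  + by rewrite -comp_assoc ek' comp_assoc qφ -!comp_assoc pr2b !comp_assoc.
Qed.

End StableFactorisation.

(** Cleavages, fibre products and left adjoints are data, whereas the hypotheses only assert
    existence; choice bridges the two. *)
Definition inhabited_elim (T : Type) (i : inhabited T) : T :=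
  proj1_sig (constructive_indefinite_description (fun _ : T => True)
    (match i with inhabits x => ex_intro _ x I end)).

Lemma eq_to_hom_iso (C : category) (X Y : C) (e : X = Y) : is_iso (eq_to_hom e).
Proof. by case: Y / e; exists (idc X); rewrite comp_id_l. Qed.

(** * Fibres of the codomain fibration described inside [C] *)

Section RightClassFibration.
Variables (C : category) (R : arrow_class C).

Definition over_dom (X : C) (A : over_obj (cod_restr R) X) : C :=
  arr_dom (proj1_sig (proj1_sig A)).

(** The codomain of an object over [X] is only propositionally equal to [X]; transporting gives a
    genuine arrow into [X]. *)
Definition over_map (X : C) (A : over_obj (cod_restr R) X) : hom (over_dom A) X :=
  match proj2_sig A in _ = Y return hom (over_dom A) Y with
    eq_refl => arr_map (proj1_sig (proj1_sig A))
  end.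

Definition over_arrow (X D : C) (a : hom D X) (Ra : R a) : over_obj (cod_restr R) X :=
  exist (fun A => cod_restr R A = X)
    (exist (in_class R) (Arrow a) Ra) eq_refl.

Lemma over_map_right (X : C) (A : over_obj (cod_restr R) X) : R (over_map A).
Proof. by case: A => [[a Ra] e]; case: X / e. Qed.

Lemma over_mapE (X : C) (A : over_obj (cod_restr R) X) :
  over_map A = eq_to_hom (proj2_sig A) ∘ arr_map (proj1_sig (proj1_sig A)).
Proof. by case: A => [[a Ra] e]; case: X / e; rewrite /= comp_id_l. Qed.

Section OverHom.
Variables (X Y : C) (u : hom X Y).
Variables (A : over_obj (cod_restr R) X) (A' : over_obj (cod_restr R) Y).

Definition top (φ : over_hom u A A') : hom (over_dom A) (over_dom A') :=
  fst (proj1_sig (proj1_sig φ)).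

Lemma top_comm (φ : over_hom u A A') : over_map A' ∘ top φ = u ∘ over_map A.
Proof.
case: φ => [[[t v] e] o]; have /= e1 := e; have := o; rewrite /is_over /= => o1.
by rewrite !over_mapE /top /= -comp_assoc e1 !comp_assoc o1.
Qed.

(** The bottom arrow is forced by [u], since [eq_to_hom] is invertible. With [over_hom_ex], arrows
    over [u] thus amount to their tops, and equations between them can be checked in [C]. *)
Lemma top_inj (φ ψ : over_hom u A A') : top φ = top ψ -> φ = ψ.
Proof.
case: φ ψ => [[[t v] e] o] [[[t' v'] e'] o'].
rewrite /top /= => et; apply: sig_val_inj; apply: sig_val_inj => /=; congr (_, _) => //.
have [i [ie _]] := eq_to_hom_iso (proj2_sig A').
move: o o'; rewrite /is_over /= => o o'.
by rewrite -(comp_id_l v) -(comp_id_l v') -ie -!comp_assoc o o'.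
Qed.

Lemma over_hom_ex (t : hom (over_dom A) (over_dom A')) :
  over_map A' ∘ t = u ∘ over_map A -> exists φ : over_hom u A A', top φ = t.
Proof.
rewrite !over_mapE => e.
have [i [ie ei]] := eq_to_hom_iso (proj2_sig A').
have e1 : arr_map (proj1_sig (proj1_sig A')) ∘ t =
    i ∘ u ∘ eq_to_hom (proj2_sig A) ∘ arr_map (proj1_sig (proj1_sig A)).
  by rewrite -2!comp_assoc -e !comp_assoc ie comp_id_l.
pose φ : hom (proj1_sig A) (proj1_sig A') := exist _ (t, _) e1.
have o : is_over u φ.
  by rewrite /is_over /= !comp_assoc ei comp_id_l.
by exists (exist _ φ o).
Qed.

End OverHom.

Lemma top_comp (X Y Z : C) (v : hom Y Z) (u : hom X Y) (A : over_obj (cod_restr R) X)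
    (A' : over_obj (cod_restr R) Y) (A'' : over_obj (cod_restr R) Z)
    (ψ : over_hom v A' A'') (φ : over_hom u A A') :
  top (over_comp ψ φ) = top ψ ∘ top φ.
Proof. by []. Qed.

Lemma top_fibre_comp (X : C) (A B D : fibre (cod_restr R) X) (g : hom B D) (f : hom A B) :
  top (g ∘ f) = top g ∘ top f.
Proof. by []. Qed.

Lemma top_fibre_id (X : C) (A : fibre (cod_restr R) X) : top (idc A) = idc _.
Proof. by []. Qed.

Lemma fibre_top_comm (X : C) (A B : fibre (cod_restr R) X) (f : hom A B) :
  over_map B ∘ top f = over_map A.
Proof. by rewrite top_comm comp_id_l. Qed.

Lemma fibre_hom_ex (X : C) (A B : fibre (cod_restr R) X)
    (t : hom (over_dom A) (over_dom B)) :
  over_map B ∘ t = over_map A -> exists f : hom A B, top f = t.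
Proof. by move=> e; apply: over_hom_ex; rewrite comp_id_l. Qed.

Lemma cartesian_of_pullback (X Y : C) (u : hom X Y) (A : over_obj (cod_restr R) X)
    (A' : over_obj (cod_restr R) Y) (φ : over_hom u A A') :
  is_pullback (over_map A) (top φ) u (over_map A') -> inhabited (cartesian φ).
Proof.
move=> pb.
have ex (W : C) (w : hom W X) (D : over_obj (cod_restr R) W)
    (ψ : over_hom (u ∘ w) D A') : exists χ : over_hom w D A, over_comp φ χ = ψ.
  have [|h [ah φh]] := pullback_lift (a := w ∘ over_map D) (b := top ψ) pb.
    by rewrite top_comm comp_assoc.
  have [χ eχ] := over_hom_ex ah.
  by exists χ; apply: top_inj; rewrite top_comp eχ.
pose f W w D ψ := constructive_indefinite_description _ (ex W w D ψ).
split; apply: (@Cartesian _ _ _ _ _ _ _ _ φ (fun W w D ψ => proj1_sig (f W w D ψ))).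
  by move=> W w D ψ; apply: (proj2_sig (f W w D ψ)).
move=> W w D ψ χ; rewrite -{1}(proj2_sig (f W w D ψ)) => e.
apply: top_inj; apply: (pullback_ext pb); first by rewrite !top_comm.
by rewrite -!top_comp e.
Qed.

Lemma fibre_product_of_pullback (X : C) (A B D : fibre (cod_restr R) X)
    (p : hom D A) (q : hom D B) :
  is_pullback (top p) (top q) (over_map A) (over_map B) -> is_product p q.
Proof.
move=> pb Z f g.
have [|h [ph qh]] := pullback_lift (a := top f) (b := top g) pb.
  by rewrite !fibre_top_comm.
have [|k ek] := fibre_hom_ex (A := Z) (B := D) (t := h).
  by rewrite -(fibre_top_comm p) -comp_assoc ph fibre_top_comm.
exists k; split.
  by split; apply: top_inj; rewrite top_fibre_comp ek.
move=> k' [pk' qk']; apply: top_inj; apply: (pullback_ext pb).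
  by rewrite ek ph -pk'.
by rewrite ek qh -qk'.
Qed.

(** * Cartesian arrows and fibre products as pullbacks in [C] *)

Variable L : arrow_class C.
Hypothesis wfs : weak_factorisation_system L R.

(** Cartesianness tests only against objects of [R]; a cone with arbitrary vertex [V] is reached
    through the identity of [V], which is in [R]. *)
Lemma cartesian_pullback (X Y : C) (u : hom X Y) (A : over_obj (cod_restr R) X)
    (A' : over_obj (cod_restr R) Y) (φ : over_hom u A A') :
  cartesian φ -> is_pullback (over_map A) (top φ) u (over_map A').
Proof.
move=> cφ; apply: is_pullback_intro => [|V x y e|V h h' e1 e2].
- by rewrite top_comm.
- pose D := over_arrow (right_class_id wfs V).
  have [|ψ eψ] := over_hom_ex (u := u ∘ x) (A := D) (A' := A') (t := y).
    by rewrite -e comp_id_r.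
  exists (top (cart_factor cφ ψ)); split.
    by apply: (eq_trans (top_comm (cart_factor cφ ψ))); rewrite comp_id_r.
  by rewrite -eψ -{2}(cart_factorK cφ ψ).
- pose D := over_arrow (right_class_id wfs V).
  have [|χ eχ] := over_hom_ex (u := over_map A ∘ h) (A := D) (A' := A) (t := h).
    by rewrite comp_id_r.
  have [|χ' eχ'] := over_hom_ex (u := over_map A ∘ h) (A := D) (A' := A) (t := h').
    by rewrite e1 comp_id_r.
  suff exx : χ = χ' by rewrite -eχ -eχ' exx.
  rewrite (cart_uniq cφ (χ := χ) eq_refl); symmetry; apply: cart_uniq.
  by apply: top_inj; rewrite !top_comp eχ eχ' e2.
Qed.

Section Reindexing.
Variables (c : cleavage (cod_restr R)) (X Y : C) (u : hom X Y).

Lemma lift_pullback (A : fibre (cod_restr R) Y) :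
  is_pullback (over_map (pull c u A)) (top (lift c u A)) u (over_map A).
Proof. exact: (cartesian_pullback (lift_cart c u A)). Qed.

Lemma top_factor (A : fibre (cod_restr R) Y) (W : C) (w : hom W X)
    (D : fibre (cod_restr R) W) (ψ : over_hom (u ∘ w) D A) :
  top (lift c u A) ∘ top (factor c ψ) = top ψ.
Proof. exact: (f_equal (fun φ => fst (proj1_sig φ)) (factorK c ψ)). Qed.

Lemma top_reindex (A B : fibre (cod_restr R) Y) (f : hom A B) :
  top (lift c u B) ∘ top (fmap (reindex c u) f) = top f ∘ top (lift c u A).
Proof. by rewrite top_factor. Qed.

Lemma lift_ext (A : fibre (cod_restr R) Y) (D : fibre (cod_restr R) X)
    (f g : hom D (pull c u A)) :
  top (lift c u A) ∘ top f = top (lift c u A) ∘ top g -> f = g.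
Proof.
move=> e; apply: top_inj; apply: (pullback_ext (lift_pullback A)) => //.
by rewrite !fibre_top_comm.
Qed.

Lemma lift_factor_ex (A : fibre (cod_restr R) Y) (D : fibre (cod_restr R) X)
    (t : hom (over_dom D) (over_dom A)) :
  over_map A ∘ t = u ∘ over_map D ->
  exists f : hom D (pull c u A), top (lift c u A) ∘ top f = t.
Proof.
move=> e; have [|h [ah lh]] := pullback_lift (a := over_map D) (b := t) (lift_pullback A).
  by [].
by have [f ef] := fibre_hom_ex ah; exists f; rewrite ef.
Qed.

End Reindexing.

Lemma top_exchange (c : cleavage (cod_restr R)) (W X X' Z : C) (u : hom W X)
    (v : hom X Z) (u' : hom W X') (v' : hom X' Z) (e : v ∘ u = v' ∘ u')
    (D : fibre (cod_restr R) Z) :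
  top (lift c v' D) ∘ (top (lift c u' (pull c v' D)) ∘ top (exchange c e D)) =
  top (lift c v D) ∘ top (lift c u (pull c v D)).
Proof. by rewrite top_factor top_factor. Qed.

Hypothesis orthogonal : unique_fillers L R.

(** The product is universal only for objects of the fibre. For an arbitrary vertex [V], the arrow
    from [V] to [X] is factored as [r ∘ l], and fillers extend the cone along [l] to one with vertex
    [r]. *)
Lemma fibre_product_pullback (X : C) (F : finite_products (fibre (cod_restr R) X))
    (A B : fibre (cod_restr R) X) :
  is_pullback (top (pr1 F (X := A) (Y := B))) (top (pr2 F)) (over_map A) (over_map B).
Proof.
apply: is_pullback_intro => [|V x y e|V h h' e1 e2].
- by rewrite !fibre_top_comm.
- have [M [l [r [Ll [Rr er]]]]] := wfs_factor wfs (over_map A ∘ x).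
  have [|x' [x'l ax']] := wfs_filler wfs (u := x) (v := r) Ll (over_map_right A).
    by rewrite er.
  have [|y' [y'l by']] := wfs_filler wfs (u := y) (v := r) Ll (over_map_right B).
    by rewrite er.
  have [f ef] := fibre_hom_ex (A := over_arrow Rr) ax'.
  have [g eg] := fibre_hom_ex (A := over_arrow Rr) by'.
  exists (top (pairing F f g) ∘ l).
  by rewrite !comp_assoc -!top_fibre_comp pairing_pr1 pairing_pr2 ef eg.
- have eh : over_map (bprod F A B) ∘ h = over_map (bprod F A B) ∘ h'.
    by rewrite -!(fibre_top_comm (pr1 F)) -!comp_assoc e1.
  have RP := over_map_right (bprod F A B).
  have [M [l [r [Ll [Rr er]]]]] := wfs_factor wfs (over_map (bprod F A B) ∘ h).
  have [|k [kl rk]] := wfs_filler wfs (u := h) (v := r) Ll RP; first by rewrite er.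
  have [|k' [k'l rk']] := wfs_filler wfs (u := h') (v := r) Ll RP.
    by rewrite er eh.
  have [f ef] := fibre_hom_ex (A := over_arrow Rr) rk.
  have [f' ef'] := fibre_hom_ex (A := over_arrow Rr) rk'.
  (* The extensions of [h] and [h'] have equal projections because these agree along [l] and over
     [X]; this is where unique fillers enter. *)
  suff ff' : f = f' by rewrite -kl -k'l -ef -ef' ff'.
  apply: bprod_ext; apply: top_inj; rewrite !top_fibre_comp ef ef'.
    apply: (left_class_epi orthogonal Ll (over_map_right A)).
      by rewrite !comp_assoc fibre_top_comm rk rk'.
    by rewrite -!comp_assoc kl k'l.
  apply: (left_class_epi orthogonal Ll (over_map_right B)).
    by rewrite !comp_assoc fibre_top_comm rk rk'.
  by rewrite -!comp_assoc kl k'l.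
Qed.

(** Comparison with the identity of [X]: [over_map (one F)] is the top of an arrow to it, and [bang]
    provides the inverse. *)
Lemma fibre_one_iso (X : C) (F : finite_products (fibre (cod_restr R) X)) :
  is_iso (over_map (one F)).
Proof.
have Ri := right_class_id wfs X.
have [|f ef] := fibre_hom_ex (A := one F) (B := over_arrow Ri) (t := over_map (one F)).
  by rewrite comp_id_l.
pose m := bang F (over_arrow Ri).
exists (top m); split; last exact: (fibre_top_comm m).
have mf : m ∘ f = idc (one F) by exact: (eq_trans (bang_uniq _) (eq_sym (bang_uniq _))).
by rewrite -ef; exact: (f_equal (fun k => top k) mf).
Qed.

Lemma reindex_preserves_finite_products (c : cleavage (cod_restr R)) (X Y : C)
    (u : hom X Y) (F : finite_products (fibre (cod_restr R) Y)) :
  preserves_finite_products F (reindex c u).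
Proof.
split=> [D|A B].
  have [i [io oi]] := fibre_one_iso F.
  have [|f ef] := lift_factor_ex c (u := u) (A := one F) (D := D) (t := i ∘ (u ∘ over_map D)).
    by rewrite comp_assoc oi comp_id_l.
  exists f; split=> // g _; apply: (lift_ext (c := c)).
  rewrite -(comp_id_l (_ ∘ top f)) -(comp_id_l (_ ∘ top g)) -io -!comp_assoc.
  by rewrite !(comp_assoc (over_map _)) !top_comm -!comp_assoc !fibre_top_comm.
have pb := fibre_product_pullback F A B.
move=> D f g.
(* The two arrows are composed with the lifts, glued in the pullback over [Y], and the result is
   factored back through the lift of the product. *)
have [|h [ph qh]] := pullback_lift (a := top (lift c u A) ∘ top f)
    (b := top (lift c u B) ∘ top g) pb.
  by rewrite !comp_assoc !top_comm -!comp_assoc !fibre_top_comm.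
have [|k ek] := lift_factor_ex c (u := u) (A := bprod F A B) (D := D) (t := h).
  rewrite -(fibre_top_comm (pr1 F)) -comp_assoc ph comp_assoc top_comm -comp_assoc.
  by rewrite fibre_top_comm.
exists k; split.
  by split; apply: (lift_ext (c := c)); rewrite top_fibre_comp comp_assoc top_reindex
    -comp_assoc ek.
move=> k' [pk qk]; apply: (lift_ext (c := c)); rewrite ek.
apply: (pullback_ext pb).
  by rewrite ph -pk top_fibre_comp !comp_assoc top_reindex.
by rewrite qh -qk top_fibre_comp !comp_assoc top_reindex.
Qed.

Hypothesis pullbacks : has_pullbacks_of R.

Lemma fibre_finite_products (X : C) : inhabited (finite_products (fibre (cod_restr R) X)).
Proof.
have ex (A B : fibre (cod_restr R) X) : exists D (pq : hom D A * hom D B),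
    is_product (fst pq) (snd pq).
  have [D [p [q pb]]] := pullbacks (over_map A) (over_map_right B).
  (* The fibre product is the diagonal of the pullback square, in [R] by stability under pullback
     and composition. *)
  have RD : R (over_map A ∘ p).
    exact: (right_class_comp wfs (right_class_pullback wfs pb (over_map_right B)) (over_map_right A)).
  have [f ef] := fibre_hom_ex (A := over_arrow RD) (B := A) (t := p) eq_refl.
  have [|g eg] := fibre_hom_ex (A := over_arrow RD) (B := B) (t := q).
    by rewrite -(proj1 pb).
  exists (over_arrow RD), (f, g); apply: fibre_product_of_pullback.
  by rewrite ef eg.
pose D A B := constructive_indefinite_description _ (ex A B).
pose pq A B := constructive_indefinite_description _ (proj2_sig (D A B)).
have prod A B Z f g := constructive_indefinite_description _ (proj2_sig (pq A B) Z f g).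
have ter A : exists f : hom A (over_arrow (right_class_id wfs X) : fibre _ X),
    top f = over_map A.
  by apply: fibre_hom_ex; rewrite comp_id_l.
split; refine (@FiniteProducts (fibre (cod_restr R) X) (over_arrow (right_class_id wfs X))
  (fun A => proj1_sig (constructive_indefinite_description _ (ter A))) _
  (fun A B => proj1_sig (D A B)) (fun A B => fst (proj1_sig (pq A B)))
  (fun A B => snd (proj1_sig (pq A B)))
  (fun Z A B f g => proj1_sig (prod A B Z f g)) _ _ _).
- move=> A f; case: constructive_indefinite_description => g /= eg.
  by apply: top_inj; rewrite eg -(fibre_top_comm f) comp_id_l.
- by move=> Z A B f g; case: prod => h [[]].
- by move=> Z A B f g; case: prod => h [[]].
- by move=> Z A B f g h; case: prod => h' /= [_ un] pf pg; rewrite (un h).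
Qed.

Lemma cod_restr_fibration : inhabited (fibration_with_products (cod_restr R)).
Proof.
have ex (X Y : C) (u : hom X Y) (A : fibre (cod_restr R) Y) :
    inhabited {B : fibre (cod_restr R) X & {φ : over_hom u B A & cartesian φ}}.
  have [D [p [q pb]]] := pullbacks u (over_map_right A).
  have Rp := right_class_pullback wfs pb (over_map_right A).
  have [|φ eφ] := over_hom_ex (u := u) (A := over_arrow Rp) (A' := A) (t := q).
    by rewrite -(proj1 pb).
  have [|cφ] := cartesian_of_pullback (φ := φ); first by rewrite eφ.
  by split; exists (over_arrow Rp), φ.
pose l X Y u A := inhabited_elim (ex X Y u A).
pose c := @Cleavage _ _ (cod_restr R) (fun X Y u A => projT1 (l X Y u A))
  (fun X Y u A => projT1 (projT2 (l X Y u A))) (fun X Y u A => projT2 (projT2 (l X Y u A))).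
pose F X := inhabited_elim (fibre_finite_products X).
split; exists c F => X Y u; exact: reindex_preserves_finite_products.
Qed.

(* By orthogonality an arrow over [u] with top in [L] is opcartesian. *)
Lemma left_class_factor (X Y : C) (u : hom X Y) (A : fibre (cod_restr R) X)
    (E D : fibre (cod_restr R) Y) (η : over_hom u A E) (ψ : over_hom u A D) :
  L (top η) -> exists f : hom E D, top f ∘ top η = top ψ.
Proof.
move=> Lη.
have [|d [dη ed]] :=
  wfs_filler wfs (u := top ψ) (v := over_map E) Lη (over_map_right D).
  by rewrite !top_comm.
by have [f ef] := fibre_hom_ex ed; exists f; rewrite ef.
Qed.

Lemma left_class_ext (X Y : C) (u : hom X Y) (A : fibre (cod_restr R) X)
    (E D : fibre (cod_restr R) Y) (η : over_hom u A E) (f g : hom E D) :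
  L (top η) -> top f ∘ top η = top g ∘ top η -> f = g.
Proof.
move=> Lη e; apply: top_inj.
apply: (left_class_epi orthogonal Lη (over_map_right D)) => //.
by rewrite !fibre_top_comm.
Qed.

(** [f] compares two factorisations of [u ∘ over_map A]. Both Frobenius reciprocity and
    Beck-Chevalley are reduced to this criterion. *)
Lemma left_class_iso (X Y : C) (u : hom X Y) (A : fibre (cod_restr R) X)
    (E D : fibre (cod_restr R) Y) (η : over_hom u A E) (f : hom E D) :
  L (top η) -> L (top f ∘ top η) -> is_iso f.
Proof.
move=> Lη Lfη.
have [g [eg [gf fg]]] := factorisation_uniq wfs orthogonal Lη (over_map_right E) Lfη
  (over_map_right D) (fibre_top_comm f).
have [g' eg'] := fibre_hom_ex eg.
by exists g'; split; apply: top_inj; rewrite top_fibre_comp eg' ?gf ?fg top_fibre_id.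
Qed.

(** * The left adjoint to reindexing, for any choice of factorisations *)

Section DirectImage.
Variables (X Y : C) (u : hom X Y).
Variable E : fibre (cod_restr R) X -> fibre (cod_restr R) Y.
Variable η : forall A, over_hom u A (E A).
Hypothesis Lη : forall A, L (top (η A)).

Definition opfactor (A : fibre (cod_restr R) X) (D : fibre (cod_restr R) Y)
    (ψ : over_hom u A D) : hom (E A) D :=
  proj1_sig (constructive_indefinite_description _ (left_class_factor ψ (Lη A))).

Lemma top_opfactor (A : fibre (cod_restr R) X) (D : fibre (cod_restr R) Y)
    (ψ : over_hom u A D) : top (opfactor ψ) ∘ top (η A) = top ψ.
Proof. by rewrite /opfactor; case: constructive_indefinite_description. Qed.

Lemma opfactor_ext (A : fibre (cod_restr R) X) (D : fibre (cod_restr R) Y)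
    (f g : hom (E A) D) : top f ∘ top (η A) = top g ∘ top (η A) -> f = g.
Proof. exact: left_class_ext. Qed.

Definition direct_image_map (A B : fibre (cod_restr R) X) (f : hom A B) : hom (E A) (E B) :=
  opfactor (over_cast (comp_id_r u) (over_comp (η B) f)).

Lemma top_direct_image_map (A B : fibre (cod_restr R) X) (f : hom A B) :
  top (direct_image_map f) ∘ top (η A) = top (η B) ∘ top f.
Proof. exact: top_opfactor. Qed.

#[local] Obligation Tactic := idtac.

Program Definition direct_image : functor (fibre (cod_restr R) X) (fibre (cod_restr R) Y) :=
  {| fobj := E; fmap := direct_image_map |}.
Next Obligation.
move=> A; apply: opfactor_ext.
by rewrite top_direct_image_map !top_fibre_id comp_id_l comp_id_r.
Qed.
Next Obligation.
move=> A B D g f; apply: opfactor_ext.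
by rewrite top_fibre_comp -comp_assoc !top_direct_image_map comp_assoc
  top_direct_image_map -comp_assoc.
Qed.

Variable c : cleavage (cod_restr R).

Definition direct_image_unit (A : fibre (cod_restr R) X) :
    @hom (fibre (cod_restr R) X) A (pull c u (E A)) :=
  factor c (over_cast (eq_sym (comp_id_r u)) (η A)).

Definition direct_image_counit (D : fibre (cod_restr R) Y) : hom (E (pull c u D)) D :=
  opfactor (lift c u D).

Lemma top_unit (A : fibre (cod_restr R) X) :
  top (lift c u (E A)) ∘ top (direct_image_unit A) = top (η A).
Proof. by rewrite top_factor. Qed.

Lemma top_counit (D : fibre (cod_restr R) Y) :
  top (direct_image_counit D) ∘ top (η (pull c u D)) = top (lift c u D).
Proof. exact: top_opfactor. Qed.

(** Arrows out of [E A] are tested on [η A] and arrows into a reindexed object on its lift; there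
    the unit becomes [η] and the counit becomes the lift. *)
Program Definition direct_image_adjunction : adjunction direct_image (reindex c u) :=
  {| adj_unit := direct_image_unit; adj_counit := direct_image_counit |}.
Next Obligation.
move=> A B f; apply: (lift_ext (c := c)).
rewrite !top_fibre_comp !comp_assoc top_reindex top_unit -comp_assoc top_unit.
exact: top_direct_image_map.
Qed.
Next Obligation.
move=> A B f; apply: opfactor_ext.
rewrite !top_fibre_comp -!comp_assoc top_counit [top (direct_image_map _) ∘ _]top_direct_image_map.
by rewrite comp_assoc top_counit top_reindex.
Qed.
Next Obligation.
move=> A; apply: opfactor_ext.
rewrite top_fibre_comp -comp_assoc top_direct_image_map comp_assoc top_counit.
by rewrite top_unit comp_id_l.
Qed.
Next Obligation.
move=> D; apply: (lift_ext (c := c)).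
rewrite top_fibre_comp comp_assoc top_reindex -comp_assoc top_unit top_counit.
by rewrite comp_id_r.
Qed.

End DirectImage.
End RightClassFibration.

(** * Frobenius reciprocity and Beck-Chevalley for the diagonals *)

Section Elementary.
Variables (C : category) (P : finite_products C) (L R : arrow_class C).
Hypothesis wfs : weak_factorisation_system L R.
Hypothesis pullbacks : has_pullbacks_of R.
Hypothesis L_products : closed_under_products P L.
Hypothesis L_pullbacks : closed_under_pullback_along L R.
Hypothesis orthogonal : unique_fillers L R.

Lemma diag_image_ex (Y X : C) (A : fibre (cod_restr R) (bprod P Y X)) :
  inhabited {E : fibre (cod_restr R) (bprod P (bprod P Y X) X) &
    {η : over_hom (pdiag P Y X) A E |
       L (top η) /\ stable_factorisation L (over_map A) (over_map E) (top η)}}.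
Proof.
have [E [e [φ [Re [Lφ [eφ st]]]]]] :=
  stable_factorisation_ex wfs pullbacks L_products L_pullbacks (over_map_right A).
have [η eη] := over_hom_ex (A := A) (A' := over_arrow Re) eφ.
split; exists (over_arrow Re), η; by rewrite eη.
Qed.

Section DiagImage.
Variables Y X : C.

Definition diag_image_obj (A : fibre (cod_restr R) (bprod P Y X)) :=
  projT1 (inhabited_elim (diag_image_ex A)).

Definition diag_image_arrow (A : fibre (cod_restr R) (bprod P Y X)) :
    over_hom (pdiag P Y X) A (diag_image_obj A) :=
  proj1_sig (projT2 (inhabited_elim (diag_image_ex A))).

Lemma diag_image_left (A : fibre (cod_restr R) (bprod P Y X)) :
  L (top (diag_image_arrow A)).
Proof. exact: (proj1 (proj2_sig (projT2 (inhabited_elim (diag_image_ex A))))). Qed.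

Lemma diag_image_stable (A : fibre (cod_restr R) (bprod P Y X)) :
  stable_factorisation L (over_map A) (over_map (diag_image_obj A))
    (top (diag_image_arrow A)).
Proof. exact: (proj2 (proj2_sig (projT2 (inhabited_elim (diag_image_ex A))))). Qed.

End DiagImage.

Variable F : fibration_with_products (cod_restr R).

Definition diag_image : diag_exists (cod_restr R) P := fun Y X =>
  direct_image wfs orthogonal (@diag_image_left Y X).

Definition diag_image_adjunction : diag_adjunction F diag_image := fun Y X =>
  direct_image_adjunction wfs orthogonal (@diag_image_left Y X) F.

Lemma top_diag_image (Y X : C) (A B : fibre (cod_restr R) (bprod P Y X)) (f : hom A B) :
  top (fmap (diag_image Y X) f) ∘ top (diag_image_arrow A) =
  top (diag_image_arrow B) ∘ top f.
Proof. exact: top_direct_image_map. Qed.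

Lemma top_diag_unit (Y X : C) (A : fibre (cod_restr R) (bprod P Y X)) :
  top (lift F (pdiag P Y X) (diag_image Y X A)) ∘
    top (adj_unit (diag_image_adjunction Y X) A) = top (diag_image_arrow A).
Proof. exact: top_unit. Qed.

Lemma top_diag_counit (Y X : C) (D : fibre (cod_restr R) (bprod P (bprod P Y X) X)) :
  top (adj_counit (diag_image_adjunction Y X) D) ∘
    top (diag_image_arrow (reindex F (pdiag P Y X) D)) = top (lift F (pdiag P Y X) D).
Proof. exact: top_counit. Qed.

Lemma diag_image_frobenius : frobenius_reciprocity diag_image_adjunction.
Proof.
move=> Y X A D; apply: (left_class_iso wfs orthogonal (diag_image_left _)).
set η := diag_image_arrow _; set G := fib_prod F (bprod P (bprod P Y X) X).
set m := _ ∘ top η.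
have m1 : top (pr1 G) ∘ m = top (lift F (pdiag P Y X) D) ∘ top (pr1 (fib_prod F _)).
  rewrite /m /frobenius_arrow comp_assoc -top_fibre_comp pairing_pr1 top_fibre_comp.
  by rewrite -comp_assoc top_diag_image comp_assoc top_diag_counit.
have m2 : top (pr2 G) ∘ m = top (diag_image_arrow A) ∘ top (pr2 (fib_prod F _)).
  rewrite /m /frobenius_arrow comp_assoc -top_fibre_comp pairing_pr2.
  by rewrite top_diag_image.
clearbody m.
have pbG := fibre_product_pullback wfs orthogonal G D (diag_image Y X A).
have pbD := lift_pullback wfs F (pdiag P Y X) D.
have pb := fibre_product_pullback wfs orthogonal (fib_prod F _) (reindex F (pdiag P Y X) D) A.
(* [m] is the pullback of the [L]-part of [A] along the projection [pr2 G], itself in [R] as a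
   pullback of [over_map D]. *)
apply: (L_pullbacks (q := top (pr2 (fib_prod F _))) (r := top (pr2 G)) (l := top (diag_image_arrow A))).
- apply: is_pullback_intro => [//|V x y e|V h h' e1 e2].
  (* By [pbD] and [pb], an arrow into the source of [m] amounts to arrows into [A] and [D] agreeing
     over the diagonal; [z] is the part in the reindexed [D]. *)
  + have [|z [z1 z2]] := pullback_lift (a := over_map A ∘ y) (b := top (pr1 G) ∘ x) pbD.
      rewrite comp_assoc -(top_comm (diag_image_arrow A)) -comp_assoc -e !comp_assoc.
      by rewrite !fibre_top_comm.
    have [h [h1 h2]] := pullback_lift (a := z) (b := y) pb z1.
    exists h; split=> //; apply: (pullback_ext pbG).
      by rewrite comp_assoc m1 -comp_assoc h1.
    by rewrite comp_assoc m2 -comp_assoc h2 e.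
  + apply: (pullback_ext pb) => //; apply: (pullback_ext pbD).
      by rewrite !comp_assoc (proj1 pb) -!comp_assoc e2.
    by rewrite !comp_assoc -m1 -!comp_assoc e1.
- exact: (right_class_pullback wfs (pullback_sym pbG) (over_map_right D)).
- exact: diag_image_left.
Qed.

Lemma diag_image_beck_chevalley : beck_chevalley diag_image_adjunction.
Proof.
move=> Y Z X f A; apply: (left_class_iso wfs orthogonal (diag_image_left _)).
(* The composite of the comparison with the [L]-part plays the role of [k] in
   [stable_factorisation]; what remains is that it lies over the diagonal and is induced by
   [diag_image_arrow A]. *)
apply: (diag_image_stable (lift_pullback wfs F (times_map P f X) A)
  (lift_pullback wfs F (times_map P (times_map P f X) X) (diag_image Z X A))).
  by rewrite comp_assoc fibre_top_comm top_comm.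
set ex := exchange F (pdiag_nat P X f) (diag_image Z X A).
set un := fmap (reindex F (times_map P f X)) (adj_unit (diag_image_adjunction Z X) A).
(* Composed with the [L]-part, the counit turns into a lift, leaving only the transposed arrow. *)
have -> : top (beck_chevalley_arrow diag_image_adjunction f A) ∘ top (diag_image_arrow _) =
    top (lift F (pdiag P Y X) _) ∘ top ex ∘ top un.
  rewrite /beck_chevalley_arrow top_fibre_comp -comp_assoc top_diag_image.
  by rewrite comp_assoc top_diag_counit -comp_assoc.
rewrite comp_assoc top_exchange -comp_assoc top_reindex comp_assoc.
by rewrite top_diag_unit.
Qed.

End Elementary.

Theorem corollary5p2 (C : category) (P : finite_products C) (L R : arrow_class C)
    (wfs : weak_factorisation_system L R)
    (pullbacks : has_pullbacks_of R)
    (L_products : closed_under_products P L)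
    (L_pullbacks : closed_under_pullback_along L R)
    (orthogonal : unique_fillers L R) :
  elementary (cod_restr R) P.
Proof.
split; first exact: (cod_restr_fibration wfs orthogonal pullbacks).
(* The left adjoints do not depend on [F]; only the adjunction data do. *)
move=> F; exists (diag_image wfs pullbacks L_products L_pullbacks orthogonal).
exists (diag_image_adjunction wfs pullbacks L_products L_pullbacks orthogonal F).
split; [exact: diag_image_frobenius | exact: diag_image_beck_chevalley].
Qed.
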